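(* Let $C_n$ denote the cycle graph on $n\ge 3$ vertices. Then $\operatorname{depth}_E C_n=0$.
   Context: Let $\mathbf{k}$ be an algebraically closed field of characteristic zero. Graphs are finite and simple. For a graph $G$ with vertices $v_1,\dots,v_n$, let $E=\bigwedge_{\mathbf k}\langle e_1,\dots,e_n\rangle$ be the exterior algebra over $\mathbf{k}$ in $n$ variables, with degree-one part $E_1$, and let $I_E(G)=(e_ie_j \mid \{v_i,v_j\}\text{ is an edge of }G)\subseteq E$ be the exterior edge ideal. For a graded $E$-module $M$, an element $\ell\in E_1$ is $M$-regular if $\{m\in M\mid \ell m=0\}=\ell M$. A sequence $\ell_1,\dots,\ell_r\in E_1$ is an $M$-regular sequence if $\ell_i$ is regular on $M/(\ell_1,\dots,\ell_{i-1})M$ for all $i\le r$; $\operatorname{depth}_E M$ is the maximum length of an $M$-regular sequence. Write $\operatorname{depth}_E G=\operatorname{depth}_E E/I_E(G)$. *)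

(* Defs.v *)
From HB Require Import structures.
From mathcomp Require Import all_boot all_order all_algebra.
From mathcomp Require Import generic_quotient ring_quotient boolp ring.

Set Implicit Arguments.
Unset Strict Implicit.
Unset Printing Implicit Defensive.

Import GRing.Theory.
Local Open Scope ring_scope.

(* An element of the exterior algebra on e_0, ..., e_(n-1) is stored as its
   family of coordinates in the basis e_S = e_(i_1) ... e_(i_r), indexed by the
   subsets S = {i_1 < ... < i_r} of 'I_n. *)
Record exterior (k : comNzRingType) (n : nat) :=
  Exterior { ext_coef : {ffun {set 'I_n} -> k} }.

Arguments ext_coef : simpl never.

Section ExteriorAlgebra.
Variables (k : comNzRingType) (n : nat).
Local Notation E := (exterior k n).
Implicit Types (x y z : E) (A B C S : {set 'I_n}).

HB.instance Definition _ := [isNew for @ext_coef k n].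
HB.instance Definition _ := [Choice of E by <:].

Definition ext_of (f : {set 'I_n} -> k) : E := Exterior [ffun S => f S].

Lemma ext_ofE f S : ext_coef (ext_of f) S = f S.
Proof. by rewrite ffunE. Qed.

Lemma extP x y : (forall S, ext_coef x S = ext_coef y S) <-> x = y.
Proof. by split=> [h|-> //]; apply/val_inj/ffunP. Qed.

Definition ext_zero : E := ext_of (fun=> 0).
Definition ext_opp x : E := ext_of (fun S => - ext_coef x S).
Definition ext_add x y : E := ext_of (fun S => ext_coef x S + ext_coef y S).
Definition ext_scale (a : k) x : E := ext_of (fun S => a * ext_coef x S).

Fact ext_addA : associative ext_add.
Proof. by move=> x y z; apply/extP=> S; rewrite !ext_ofE addrA. Qed.
Fact ext_addC : commutative ext_add.
Proof. by move=> x y; apply/extP=> S; rewrite !ext_ofE addrC. Qed.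
Fact ext_add0 : left_id ext_zero ext_add.
Proof. by move=> x; apply/extP=> S; rewrite !ext_ofE add0r. Qed.
Fact ext_addN : left_inverse ext_zero ext_opp ext_add.
Proof. by move=> x; apply/extP=> S; rewrite !ext_ofE addNr. Qed.

HB.instance Definition _ :=
  GRing.isZmodule.Build E ext_addA ext_addC ext_add0 ext_addN.

Lemma ext_coef0 S : ext_coef (0 : E) S = 0.
Proof. exact: ext_ofE. Qed.
Lemma ext_coefD x y S : ext_coef (x + y) S = ext_coef x S + ext_coef y S.
Proof. exact: ext_ofE. Qed.
Lemma ext_coefN x S : ext_coef (- x) S = - ext_coef x S.
Proof. exact: ext_ofE. Qed.
Lemma ext_coef_sum I (r : seq I) (P : pred I) (F : I -> E) S :
  ext_coef (\sum_(i <- r | P i) F i) S = \sum_(i <- r | P i) ext_coef (F i) S.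
Proof.
by elim/big_rec2: _ => [|i a x _ <-]; rewrite ?ext_coef0 ?ext_coefD.
Qed.

Fact ext_scaleA a b x : ext_scale a (ext_scale b x) = ext_scale (a * b) x.
Proof. by apply/extP=> S; rewrite !ext_ofE mulrA. Qed.
Fact ext_scale1 : left_id 1 ext_scale.
Proof. by move=> x; apply/extP=> S; rewrite !ext_ofE mul1r. Qed.
Fact ext_scaleDr : right_distributive ext_scale +%R.
Proof.
by move=> a x y; apply/extP=> S; rewrite ext_coefD !ext_ofE mulrDr.
Qed.
Fact ext_scaleDl x : {morph ext_scale^~ x : a b / a + b}.
Proof.
by move=> a b; apply/extP=> S; rewrite ext_coefD !ext_ofE mulrDl.
Qed.

HB.instance Definition _ := GRing.Zmodule_isLmodule.Build k E
  ext_scaleA ext_scale1 ext_scaleDr ext_scaleDl.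

Lemma ext_coefZ a x S : ext_coef (a *: x) S = a * ext_coef x S.
Proof. exact: ext_ofE. Qed.

(* ext_sign A B is the structure constant in e_A e_B = ext_sign A B e_(A :|: B): the product
   vanishes when A and B meet, and otherwise sorting the factors takes one
   transposition for each pair (i, j) in A x B with j < i. *)
Definition ext_inv A B : nat := (\sum_(i in A) \sum_(j in B) (j < i))%N.
Definition ext_sign A B : k :=
  if [disjoint A & B] then (-1) ^+ ext_inv A B else 0.

Definition ext_one : E := ext_of (fun S => (S == set0)%:R).
Definition ext_mul x y : E := ext_of (fun S =>
  \sum_A \sum_(B | A :|: B == S) ext_sign A B * (ext_coef x A * ext_coef y B)).

Lemma ext_sign0l A : ext_sign set0 A = 1.
Proof. by rewrite /ext_sign /ext_inv -setI_eq0 set0I eqxx big_set0. Qed.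

Lemma ext_sign0r A : ext_sign A set0 = 1.
Proof.
rewrite /ext_sign /ext_inv -setI_eq0 setI0 eqxx big1 // => i _.
by rewrite big_set0.
Qed.

Lemma ext_invUl A B C : [disjoint A & B] ->
  ext_inv (A :|: B) C = (ext_inv A C + ext_inv B C)%N.
Proof.
move=> dAB; rewrite -bigU //; apply: eq_bigl => i.
by rewrite !inE.
Qed.

Lemma ext_invUr A B C : [disjoint B & C] ->
  ext_inv A (B :|: C) = (ext_inv A B + ext_inv A C)%N.
Proof.
move=> dBC; rewrite -big_split; apply: eq_bigr => i _.
by rewrite -bigU //; apply: eq_bigl => j; rewrite !inE.
Qed.

Lemma ext_signA A B C :
  ext_sign (A :|: B) C * ext_sign A B = ext_sign A (B :|: C) * ext_sign B C.
Proof.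
rewrite /ext_sign -!setI_eq0 setIUl setIUr !setU_eq0 !setI_eq0.
case dAB: [disjoint A & B]; case dAC: [disjoint A & C];
  case dBC: [disjoint B & C]; rewrite /= ?(mulr0, mul0r) //.
by rewrite ext_invUl // ext_invUr // -!exprD; congr (_ ^+ _); rewrite addnACl addnC.
Qed.

Lemma ext_mulE x y S : ext_coef (ext_mul x y) S =
  \sum_A \sum_(B | A :|: B == S) ext_sign A B * (ext_coef x A * ext_coef y B).
Proof. exact: ext_ofE. Qed.

Fact ext_mulA : associative ext_mul.
Proof.
move=> x y z; apply/extP=> S; rewrite !ext_mulE.
transitivity (\sum_A \sum_B \sum_(C | A :|: B :|: C == S)
  ext_sign A (B :|: C) * ext_sign B C *
    (ext_coef x A * ext_coef y B * ext_coef z C)).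
  apply: eq_bigr => A _.
  transitivity (\sum_T \sum_B \sum_(C | (A :|: T == S) && (B :|: C == T))
    ext_sign A T * ext_sign B C *
      (ext_coef x A * ext_coef y B * ext_coef z C)).
    rewrite big_mkcond; apply: eq_bigr => T _; rewrite ext_mulE.
    case: ifP => _; last by rewrite big1 // => B _; rewrite big_pred0.
    rewrite !mulr_sumr; apply: eq_bigr => B _.
    by rewrite !mulr_sumr; apply: eq_bigr => C _; ring.
  rewrite exchange_big; apply: eq_bigr => B _ /=.
  rewrite (exchange_big_dep (fun C => A :|: B :|: C == S)) /=; last first.
    by move=> T C _ /andP[/eqP <- /eqP <-]; rewrite setUA.
  apply: eq_bigr => C /eqP eS.
  rewrite (big_pred1 (B :|: C)) // => T /=.
  by rewrite [_ == T]eq_sym andbC; case: eqP => //= ->; rewrite setUA eS eqxx.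
symmetry.
transitivity (\sum_T \sum_A \sum_B \sum_(C | (T :|: C == S) && (A :|: B == T))
    ext_sign T C * ext_sign A B *
      (ext_coef x A * ext_coef y B * ext_coef z C)).
  apply: eq_bigr => T _.
  under eq_bigr => C _ do rewrite ext_mulE mulr_suml mulr_sumr.
  rewrite exchange_big; apply: eq_bigr => A _ /=.
  under eq_bigr => C _ do rewrite mulr_suml mulr_sumr.
  rewrite (exchange_big_dep (fun B => A :|: B == T)) //= big_mkcond.
  apply: eq_bigr => B _; case: eqP => _ /=.
    by apply: eq_big => [C|C _]; [rewrite andbT | ring].
  by rewrite big_pred0 // => C; rewrite andbF.
rewrite exchange_big; apply: eq_bigr => A _ /=.
rewrite exchange_big; apply: eq_bigr => B _ /=.
rewrite (exchange_big_dep (fun C => A :|: B :|: C == S)) /=; last first.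
  by move=> T C _ /andP[/eqP <- /eqP <-].
apply: eq_bigr => C /eqP eS.
rewrite (big_pred1 (A :|: B)) ?ext_signA // => T /=.
by rewrite [_ == T]eq_sym andbC; case: eqP => //= ->; rewrite eS eqxx.
Qed.

Fact ext_mul1 : left_id ext_one ext_mul.
Proof.
move=> x; apply/extP=> S; rewrite ext_mulE (bigD1 set0) //= [X in _ + X]big1.
  rewrite addr0 (big_pred1 S) => [|B]; last by rewrite set0U.
  by rewrite ext_sign0l ext_ofE eqxx !mul1r.
move=> A /negPf nA; rewrite big1 // => B _.
by rewrite ext_ofE nA mul0r mulr0.
Qed.

Fact ext_mulr1 : right_id ext_one ext_mul.
Proof.
move=> x; apply/extP=> S; rewrite ext_mulE (bigD1 S) //= [X in _ + X]big1.
  rewrite addr0 (bigD1 set0) ?setU0 ?eqxx //= ext_sign0r ext_ofE eqxx mulr1 mul1r.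
  by rewrite big1 ?addr0 // => B /andP[_ /negPf nB]; rewrite ext_ofE nB !mulr0.
move=> A nA; rewrite big1 // => B /eqP eS; rewrite ext_ofE.
case: eqP => [B0|_]; last by rewrite !mulr0.
by rewrite -eS B0 setU0 eqxx in nA.
Qed.

Fact ext_mulDl : left_distributive ext_mul +%R.
Proof.
move=> x y z; apply/extP=> S; rewrite ext_coefD !ext_mulE -big_split.
apply: eq_bigr => A _; rewrite -big_split; apply: eq_bigr => B _ /=.
by rewrite ext_coefD mulrDl mulrDr.
Qed.

Fact ext_mulDr : right_distributive ext_mul +%R.
Proof.
move=> x y z; apply/extP=> S; rewrite ext_coefD !ext_mulE -big_split.
apply: eq_bigr => A _; rewrite -big_split; apply: eq_bigr => B _ /=.
by rewrite ext_coefD mulrDr mulrDr.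
Qed.

Fact ext_one_neq0 : ext_one != 0.
Proof.
apply/eqP=> /extP/(_ set0)/eqP.
by rewrite ext_ofE ext_coef0 eqxx oner_eq0.
Qed.

HB.instance Definition _ := GRing.Zmodule_isNzRing.Build E
  ext_mulA ext_mul1 ext_mulr1 ext_mulDl ext_mulDr ext_one_neq0.

Lemma ext_coef1 S : ext_coef (1 : E) S = (S == set0)%:R.
Proof. exact: ext_ofE. Qed.

Lemma ext_coefM x y S : ext_coef (x * y) S =
  \sum_A \sum_(B | A :|: B == S) ext_sign A B * (ext_coef x A * ext_coef y B).
Proof. exact: ext_mulE. Qed.

Fact ext_scaleAl a x y : a *: (x * y) = (a *: x) * y.
Proof.
apply/extP=> S; rewrite ext_coefZ !ext_coefM mulr_sumr.
apply: eq_bigr => A _; rewrite mulr_sumr; apply: eq_bigr => B _ /=.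
by rewrite ext_coefZ; ring.
Qed.

Fact ext_scaleAr a x y : a *: (x * y) = x * (a *: y).
Proof.
apply/extP=> S; rewrite ext_coefZ !ext_coefM mulr_sumr.
apply: eq_bigr => A _; rewrite mulr_sumr; apply: eq_bigr => B _ /=.
by rewrite ext_coefZ; ring.
Qed.

HB.instance Definition _ := GRing.Lmodule_isLalgebra.Build k E ext_scaleAl.
HB.instance Definition _ := GRing.Lalgebra_isAlgebra.Build k E ext_scaleAr.

Definition ext_basis A : E := ext_of (fun S => (S == A)%:R).

Definition ext_gen (i : 'I_n) : E := ext_basis [set i].

Lemma ext_basis_expand x : x = \sum_S ext_coef x S *: ext_basis S.
Proof.
apply/extP=> S; rewrite ext_coef_sum (bigD1 S) //= ext_coefZ ext_ofE eqxx.
rewrite mulr1 big1 ?addr0 // => A nA.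
by rewrite ext_coefZ ext_ofE eq_sym (negPf nA) mulr0.
Qed.

Lemma ext_basisM A B :
  ext_basis A * ext_basis B = ext_sign A B *: ext_basis (A :|: B).
Proof.
apply/extP=> S; rewrite ext_coefM (bigD1 A) //= [X in _ + X]big1 ?addr0.
  rewrite big_mkcond (bigD1 B) //= [X in _ + X]big1 ?addr0.
    rewrite ext_coefZ !ext_ofE !eqxx mulr1 eq_sym.
    by case: eqP => _; rewrite ?mulr1 ?mulr0.
  by move=> C /negPf nC; rewrite !ext_ofE nC !mulr0 if_same.
move=> C /negPf nC; rewrite big1 // => D _.
by rewrite !ext_ofE nC mul0r mulr0.
Qed.

Lemma ext_basis0 : ext_basis set0 = 1.
Proof. by []. Qed.

Lemma ext_gen_sqr i : ext_gen i * ext_gen i = 0.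
Proof.
rewrite ext_basisM /ext_sign -setI_eq0 setIid.
case: eqP => [/setP/(_ i)|_]; last by rewrite scale0r.
by rewrite !inE eqxx.
Qed.

Lemma ext_gen_anticomm i j : ext_gen i * ext_gen j = - (ext_gen j * ext_gen i).
Proof.
have [->|ne] := eqVneq i j; first by rewrite ext_gen_sqr oppr0.
rewrite !ext_basisM setUC -scaleNr; congr (_ *: _).
have hd (a b : 'I_n) : a != b -> [disjoint [set a] & [set b]].
  by rewrite disjoints1 inE.
rewrite /ext_sign !hd // 1?eq_sym // /ext_inv !big_set1.
case: (ltngtP i j) => h; rewrite ?expr0 ?expr1 ?opprK //.
by rewrite (val_inj h) eqxx in ne.
Qed.

Lemma ext_basis_prod A : ext_basis A = \prod_(i <- enum A) ext_gen i.
Proof.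
pose lt := relpre val ltn : rel 'I_n.
have lt_trans : transitive lt by move=> i j l; apply: ltn_trans.
have: sorted lt (enum A).
  apply: (subseq_sorted lt_trans (s2 := enum 'I_n)).
    by rewrite {1}/enum_mem -enumT filter_subseq.
  by rewrite -sorted_map val_enum_ord iota_ltn_sorted.
have -> : ext_basis A = ext_basis [set i in enum A].
  by congr ext_basis; apply/setP=> i; rewrite inE mem_enum.
elim: (enum A) => [|i s IHs] /= s_sorted.
  by rewrite big_nil -ext_basis0; congr ext_basis; apply/setP=> i; rewrite !inE.
rewrite big_cons -IHs ?(path_sorted s_sorted) // ext_basisM.
have /allP i_lt : all (lt i) s by apply: order_path_min s_sorted.
have -> : ext_sign [set i] [set j in s] = 1.
  rewrite /ext_sign disjoints1 inE; case: ifPn => [_|]; last first.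
    by rewrite negbK => /i_lt; rewrite /lt /= ltnn.
  rewrite /ext_inv big_set1 big1 // => j; rewrite inE => /i_lt ij.
  by apply/eqP; rewrite eqb0 -leqNgt ltnW.
rewrite scale1r; congr ext_basis; apply/setP=> j.
by rewrite !inE.
Qed.

(* The degree-one part of the algebra. *)
Definition ext_deg1 x : Prop :=
  exists c : 'I_n -> k, x = \sum_(i < n) c i *: ext_gen i.

End ExteriorAlgebra.

Section Submodules.
Variables (R : nzRingType) (M : lmodType R).

Definition span_pred (X : M -> Prop) : M -> bool := fun m =>
  `[< exists (r : nat) (a : 'I_r -> R) (x : 'I_r -> M),
        (forall i, X (x i)) /\ m = \sum_(i < r) a i *: x i >].

Lemma span_predP (X : M -> Prop) (m : M) :
  reflect (exists (r : nat) (a : 'I_r -> R) (x : 'I_r -> M),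
             (forall i, X (x i)) /\ m = \sum_(i < r) a i *: x i)
          (m \in span_pred X).
Proof. exact: asboolP. Qed.

Fact span_pred_closed (X : M -> Prop) : submod_closed (span_pred X).
Proof.
split=> [|c u v /span_predP[r [a [x [Xx ->]]]] /span_predP[s [b [y [Xy ->]]]]].
  apply/span_predP; exists 0%N, (fun=> 0), (fun=> 0).
  by split=> [[]//|]; rewrite big_ord0.
apply/span_predP; exists (r + s)%N.
exists (fun i => match split i with inl j => c * a j | inr j => b j end).
exists (fun i => match split i with inl j => x j | inr j => y j end).
split=> [i|]; first by case: split.
rewrite big_split_ord scaler_sumr; congr (_ + _); apply: eq_bigr => i _.
  by rewrite (unsplitK (inl i)) scalerA.
by rewrite (unsplitK (inr i)).
Qed.

HB.instance Definition _ (X : M -> Prop) :=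
  GRing.isSubmodClosed.Build R M (span_pred X) (span_pred_closed X).

Definition submod_span (X : M -> Prop) : submodClosed M :=
  GRing.SubmodClosed.clone R M (span_pred X) _.

Lemma submod_spanP (X : M -> Prop) (m : M) :
  reflect (exists (r : nat) (a : 'I_r -> R) (x : 'I_r -> M),
             (forall i, X (x i)) /\ m = \sum_(i < r) a i *: x i)
          (m \in submod_span X).
Proof. exact: span_predP. Qed.

Lemma submod_span_gen (X : M -> Prop) (x : M) : X x -> x \in submod_span X.
Proof.
move=> Xx; apply/submod_spanP; exists 1%N, (fun=> 1), (fun=> x).
by rewrite big_ord1 scale1r.
Qed.

Lemma submod_span_min (X : M -> Prop) (N : submodClosed M) :
  (forall x, X x -> x \in N) -> {subset submod_span X <= N}.
Proof.
move=> sXN m /submod_spanP[r [a [x [Xx ->]]]].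
by apply: rpred_sum => i _; apply/rpredZ/sXN.
Qed.

End Submodules.

Section QuotientModule.
Variables (R : nzRingType) (M : lmodType R) (N : submodClosed M).

(* A copy of N carrying the additive subgroup structure, which submodClosed does
   not record. *)
Definition submod_zmod : M -> bool := fun m => m \in N.

Fact submod_zmod_closed : zmod_closed submod_zmod.
Proof.
split=> [|x y xN yN]; first exact: rpred0.
by rewrite unfold_in /submod_zmod -scaleN1r rpredD ?rpredZ.
Qed.

HB.instance Definition _ :=
  GRing.isZmodClosed.Build M submod_zmod submod_zmod_closed.

Definition submod_zmodClosed := GRing.ZmodClosed.clone M submod_zmod _.

Definition quotmod := Quotient.quot submod_zmodClosed.
HB.instance Definition _ := GRing.Zmodule.on quotmod.

Definition quotmod_pi (m : M) : quotmod :=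
  \pi_(Quotient.quot submod_zmodClosed)%qT m.

Lemma quotmod_piP (x y : M) : (quotmod_pi x == quotmod_pi y) = (x - y \in N).
Proof. exact/esym/(Quotient.idealrBE submod_zmodClosed). Qed.

Lemma quotmod_surj (q : quotmod) : exists m, quotmod_pi m = q.
Proof. by exists (repr (q : Quotient.quot submod_zmodClosed)); apply: reprK. Qed.

Definition quotmod_scale (a : R) (q : quotmod) : quotmod :=
  quotmod_pi (a *: repr (q : Quotient.quot submod_zmodClosed)).

Lemma quotmod_piB : zmod_morphism quotmod_pi.
Proof. exact: raddfB. Qed.

HB.instance Definition _ :=
  GRing.isZmodMorphism.Build M quotmod quotmod_pi quotmod_piB.

Fact quotmod_scale_pi a m : quotmod_scale a (quotmod_pi m) = quotmod_pi (a *: m).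
Proof.
apply/eqP; rewrite quotmod_piP -scalerBr rpredZ // -quotmod_piP.
by apply/eqP; apply: reprK.
Qed.

Fact quotmod_scaleA a b q :
  quotmod_scale a (quotmod_scale b q) = quotmod_scale (a * b) q.
Proof. by case: (quotmod_surj q) => m <-; rewrite !quotmod_scale_pi scalerA. Qed.
Fact quotmod_scale1 : left_id 1 quotmod_scale.
Proof.
by move=> q; case: (quotmod_surj q) => m <-; rewrite quotmod_scale_pi scale1r.
Qed.
Fact quotmod_scaleDr : right_distributive quotmod_scale +%R.
Proof.
move=> a p q; case: (quotmod_surj p) (quotmod_surj q) => x <- [y <-].
by rewrite -raddfD !quotmod_scale_pi scalerDr raddfD.
Qed.
Fact quotmod_scaleDl q : {morph quotmod_scale^~ q : a b / a + b}.
Proof.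
move=> a b; case: (quotmod_surj q) => m <-.
by rewrite !quotmod_scale_pi scalerDl raddfD.
Qed.

HB.instance Definition _ := GRing.Zmodule_isLmodule.Build R quotmod
  quotmod_scaleA quotmod_scale1 quotmod_scaleDr quotmod_scaleDl.

Lemma quotmod_piZ : scalable quotmod_pi.
Proof. by move=> a m; rewrite -quotmod_scale_pi. Qed.

HB.instance Definition _ :=
  GRing.isScalable.Build R M quotmod *:%R quotmod_pi quotmod_piZ.

End QuotientModule.

Section Depth.
Variables (k : comNzRingType) (n : nat).
Local Notation E := (exterior k n).

Definition regular_elt (M : lmodType E) (l : E) : Prop :=
  forall m : M, l *: m = 0 <-> exists m' : M, m = l *: m'.

(* M / (l_1, ..., l_r) M. *)
Definition seq_quotmod (M : lmodType E) (s : seq E) : lmodType E :=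
  quotmod (submod_span (fun y : M => exists2 l, l \in s & exists m, y = l *: m)).

Definition regular_seq (M : lmodType E) (s : seq E) : Prop :=
  forall i, (i < size s)%N ->
    ext_deg1 s`_i /\ regular_elt (seq_quotmod M (take i s)) s`_i.

(* d is the maximum length of an M-regular sequence.  Stated as a relation so
   that nothing is claimed for modules on which the lengths are unbounded. *)
Definition depth_is (M : lmodType E) (d : nat) : Prop :=
  (exists2 s, regular_seq M s & size s = d) /\
  (forall s, regular_seq M s -> (size s <= d)%N).

End Depth.

Record sgraph (n : nat) := SGraph {
  edge : rel 'I_n;
  edge_sym : symmetric edge;
  edge_irr : irreflexive edge }.

Section EdgeIdeal.
Variables (k : comNzRingType) (n : nat) (G : sgraph n).
Local Notation E := (exterior k n).

(* The two-sided ideal generated by the products e_i e_j over the edges: the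
   left ideal generated by their right multiples. *)
Definition edge_ideal : submodClosed E^o := submod_span (M := E^o)
  (fun x => exists i j b, edge G i j /\ x = ext_gen k i * ext_gen k j * b).

Definition edge_ring : lmodType E := quotmod edge_ideal.

End EdgeIdeal.

Section Cycle.
Variable n : nat.

Definition cycle_edge : rel 'I_n := fun i j =>
  (i != j) && ((j == i.+1 %% n :> nat) || (i == j.+1 %% n :> nat))%N.

Fact cycle_edge_sym : symmetric cycle_edge.
Proof. by move=> i j; rewrite /cycle_edge eq_sym orbC. Qed.

Fact cycle_edge_irr : irreflexive cycle_edge.
Proof. by move=> i; rewrite /cycle_edge eqxx. Qed.

Definition cycle_graph : sgraph n := SGraph cycle_edge_sym cycle_edge_irr.

End Cycle.

(* Main.v *)
Require Import Defs.
From mathcomp Require Import all_boot all_order all_algebra.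
From mathcomp Require Import zify ring.

(** The ring E/I(G) has a basis of monomials e_S indexed by the independent sets
    S of G, and multiplication by a linear form l raises the cardinality of S by
    one.  If l is regular, this map d has its kernel equal to its image, so the
    basis elements of even and of odd degree must balance: the alternating sum
    of (-1)^#|S| over the independent sets, which is up to sign the reduced Euler
    characteristic of the independence complex of G, vanishes.  This holds for
    every l at once, whatever its coefficients ([regular_indep_chi]).

    The balance is obtained as a supertrace (over k, which suffices in
    characteristic zero): exactness yields a contracting homotopy
    d b + b d = 1, and a parity operator anticommuting with d then has trace zero
    ([mxtrace_anticomm_exact]).

    For the cycle C_n this alternating sum is nonzero.  Deleting a vertex
    ([indep_chi_del]) gives p(m+2) = p(m+1) - p(m) for the sums p(m) of paths on m
    vertices, and p(n-1) - p(n-3) for C_n.  The recursion preserves the quadratic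
    form x^2 - xy + y^2, so consecutive values x = p(n-3) and y = p(n-2) satisfy
    x^2 - xy + y^2 = 1.  The sum for C_n is y - 2x; if it were zero, the form would
    take the value 3x^2 = 1, which has no integer solution
    ([cycle_chi_neq0]).  Hence no linear form is regular, and the only regular
    sequence is the empty one. *)

Set Implicit Arguments.
Unset Strict Implicit.

Import GRing.Theory.
Local Open Scope ring_scope.

(** * Exact differentials and the supertrace *)

(** Exactness provides B with A B + B A = 1; then
    tr D = tr (D A B) + tr (D B A) = tr ((D A + A D) B) = 0. *)
Lemma mxtrace_anticomm_exact (F : fieldType) (N : nat) (A D : 'M[F]_N) :
    A *m A = 0 -> (forall v : 'rV_N, v *m A = 0 -> (v <= A)%MS) ->
  D *m A = - (A *m D) -> \tr D = 0.
Proof.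
move=> A2 exactA DA.
have [P APA] : exists P, A *m P *m A = A by exists (pinvmx A); rewrite mulmxKpV.
(* The rows of 1 - A P are killed by A, hence lie in the row space of A. *)
have [Y YA] : exists Y, Y *m A = 1%:M - A *m P.
  exists ((1%:M - A *m P) *m pinvmx A); rewrite mulmxKpV //.
  apply/row_subP => i; apply: exactA.
  by rewrite -row_mul mulmxBl mul1mx APA subrr row0.
have AYA : A *m Y *m A = A by rewrite -mulmxA YA mulmxBr mulmx1 mulmxA A2 mul0mx subr0.
have [B homotopy] : exists B, A *m B + B *m A = 1%:M.
  exists (Y *m A *m P); rewrite !mulmxA AYA -(mulmxA Y A P) -(mulmxA Y).
  by rewrite APA YA addrC subrK.
rewrite -[D]mulmx1 -homotopy mulmxDr mxtraceD mulmxA DA [D *m (B *m A)]mulmxA.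
by rewrite [X in _ + X]mxtrace_mulC mulmxA mulNmx raddfN addNr.
Qed.

(** * Alternating counts of independent sets *)

Section AlternatingCount.
Variables (T : finType) (e : rel T).

Definition indep (S : {set T}) : bool :=
  [forall i in S, forall j in S, ~~ e i j].

Lemma indepP (S : {set T}) :
  reflect {in S &, forall i j, ~~ e i j} (indep S).
Proof.
apply: (iffP forall_inP) => [h i j iS jS|h i iS].
  by have /forall_inP := h i iS; apply.
by apply/forall_inP => j jS; apply: h.
Qed.

Lemma indepS (A B : {set T}) : A \subset B -> indep B -> indep A.
Proof.
by move=> /subsetP AB /indepP hB; apply/indepP => i j /AB iB /AB jB; apply: hB.
Qed.

(** The independence polynomial of the subgraph induced on A, evaluated at -1. *)
Definition indep_chi (A : {set T}) : int :=
  \sum_(S : {set T} | (S \subset A) && indep S) (-1) ^+ #|S|.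

Lemma indep_chi0 : indep_chi set0 = 1.
Proof.
rewrite /indep_chi (big_pred1 set0) ?cards0 // => S; rewrite subset0 /=.
by case: eqP => //= ->; apply/indepP => i j; rewrite inE.
Qed.

Hypotheses (e_sym : symmetric e) (e_irr : irreflexive e).

(** An independent set either avoids v, or is v together with an independent
    set avoiding v and its neighbours; the latter have opposite sign. *)
Lemma indep_chi_del (A : {set T}) (v : T) : v \in A ->
  indep_chi A = indep_chi (A :\ v) - indep_chi (A :\ v :\: [set u | e v u]).
Proof.
move=> vA; rewrite /indep_chi (bigID (fun S : {set T} => v \in S)) /= addrC.
congr (_ + _).
  by apply: eq_bigl => S; rewrite subsetD1 andbAC.
rewrite -sumrN (reindex_onto (fun S => v |: S) (fun S => S :\ v)) /=; last first.
  by move=> S /andP[_ vS]; rewrite setD1K.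
apply: eq_big => [S|S /andP[_ /eqP eS]]; last first.
  have vS : v \notin S by rewrite -eS !inE eqxx.
  by rewrite cardsU1 vS exprS mulN1r.
rewrite setU11 andbT subUset sub1set vA /= subsetD subsetD1.
have [vS|vS] /= := boolP (v \in S).
  rewrite [_ == S](_ : _ = false) ?andbF //=; apply/eqP => /setP/(_ v).
  by rewrite !inE eqxx vS.
rewrite setU1K // eqxx !andbT -andbA; congr (_ && _).
apply/indepP/andP => [h|[dS /indepP h] i j].
  split; last by apply/indepP => i j iS jS; apply: h; rewrite !inE ?iS ?jS orbT.
  rewrite -setI_eq0; apply/eqP/setP => u; rewrite !inE; apply/negP => /andP[uS].
  by apply/negP/h; rewrite !inE ?eqxx ?uS ?orbT.
have nb u : u \in S -> ~~ e v u by move/(disjointFr dS); rewrite inE => ->.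
rewrite !inE => /predU1P[->|iS] /predU1P[->|jS];
  by [rewrite e_irr | exact: nb | rewrite e_sym nb | exact: h].
Qed.

End AlternatingCount.

(** * Paths and cycles *)

(** The value of [indep_chi] on a path with m vertices; it has period 6:
    1, 0, -1, -1, 0, 1. *)
Fixpoint path_chi (m : nat) : int :=
  match m with
  | 0 => 1
  | 1 => 0
  | (m1.+1 as m2).+1 => path_chi m2 - path_chi m1
  end.

(** The form x^2 - xy + y^2 is invariant under (x, y) |-> (y, y - x). *)
Lemma path_chi_norm (m : nat) :
  path_chi m ^+ 2 - path_chi m * path_chi m.+1 + path_chi m.+1 ^+ 2 = 1.
Proof. by elim: m => [|m /= <-]; ring. Qed.

Section CycleCount.
Variable n : nat.
Hypothesis n_ge3 : (3 <= n)%N.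

Definition ord_interval (a m : nat) : {set 'I_n} := [set i : 'I_n | (a <= i < a + m)%N].

Let chi := indep_chi (@cycle_edge n).

Lemma cycle_edgeE (i j : 'I_n) : cycle_edge i j =
  [|| (j == i.+1 :> nat), (i == j.+1 :> nat),
      (i == 0%N :> nat) && (j == n.-1 :> nat) | (j == 0%N :> nat) && (i == n.-1 :> nat)].
Proof.
have modS (u : 'I_n) : (u.+1 %% n = if u == n.-1 :> nat then 0 else u.+1)%N.
  case: eqP => [->|ne]; first by rewrite prednK ?modnn //; lia.
  by rewrite modn_small //; have := ltn_ord u; lia.
rewrite /cycle_edge !modS -val_eqE /=; have := ltn_ord i; have := ltn_ord j.
by case: (i =P n.-1 :> nat); case: (j =P n.-1 :> nat) => *; lia.
Qed.

Lemma chi_interval_rec (a m : nat) : (a + m.+2 < n)%N ->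
  chi (ord_interval a m.+2) = chi (ord_interval a m.+1) - chi (ord_interval a m).
Proof.
move=> am; have lt_v : (a + m.+1 < n)%N by lia.
have vI : Ordinal lt_v \in ord_interval a m.+2 by rewrite inE /=; lia.
rewrite /chi (indep_chi_del (@cycle_edge_sym n) (@cycle_edge_irr n) vI).
congr (_ - _); congr (indep_chi _ _); apply/setP => i;
  by rewrite !inE ?cycle_edgeE -val_eqE /=; have := ltn_ord i; lia.
Qed.

Lemma chi_interval (a m : nat) : (a + m < n)%N ->
  chi (ord_interval a m) = path_chi m.
Proof.
elim/ltn_ind: m => -[|[|m]] IHm am.
- rewrite (_ : ord_interval a 0 = set0) ?/chi ?indep_chi0 //.
  by apply/setP => i; rewrite !inE; lia.
- have lt_a : (a < n)%N by lia.
  rewrite (_ : ord_interval a 1 = [set Ordinal lt_a]); last first.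
    by apply/setP => i; rewrite !inE -val_eqE /=; lia.
  rewrite /chi (indep_chi_del (@cycle_edge_sym n) (@cycle_edge_irr n) (set11 _)).
  by rewrite setDv set0D indep_chi0 subrr.
by rewrite chi_interval_rec // !IHm //; lia.
Qed.

(** Opening the cycle at its last vertex leaves a path with n - 1 vertices;
    removing the two neighbours as well leaves one with n - 3 vertices. *)
Lemma cycle_chi_neq0 : chi setT != 0.
Proof.
have lt_v : (n.-1 < n)%N by lia.
have path_v : setT :\ Ordinal lt_v = ord_interval 0 n.-1.
  by apply/setP => i; rewrite !inE -val_eqE /=; have := ltn_ord i; lia.
have path_Nv : setT :\ Ordinal lt_v :\: [set u | cycle_edge (Ordinal lt_v) u] =
    ord_interval 1 (n - 3).
  by apply/setP => i; rewrite !inE cycle_edgeE -val_eqE /=; have := ltn_ord i; lia.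
rewrite /chi.
rewrite (indep_chi_del (@cycle_edge_sym n) (@cycle_edge_irr n) (in_setT (Ordinal lt_v))).
rewrite path_Nv path_v -!/(chi _) !chi_interval; [|lia|lia].
have -> : n.-1 = (n - 3).+2 by lia.
rewrite (_ : path_chi (n - 3).+2 = path_chi (n - 3).+1 - path_chi (n - 3)) //.
move: (path_chi_norm (n - 3)).
move: (path_chi (n - 3)) (path_chi (n - 3).+1) => x y norm1; apply/eqP => chi0.
have eq_y : y = 2 * x by lia.
have : 3 * x ^+ 2 = 1 by rewrite -[RHS]norm1 eq_y; ring.
lia.
Qed.

End CycleCount.

(** * Supports of products in the exterior algebra *)

Section ExteriorSupport.
Variables (k : comNzRingType) (n : nat).
Local Notation E := (exterior k n).
Implicit Types (x y : E) (A B S : {set 'I_n}).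

(** Only basis elements indexed by subsets of S contribute to the coefficient
    of a product at S.  This is what makes the elements supported on dependent
    sets a two-sided ideal. *)
Lemma ext_coefM_supl x y S :
  (forall A, A \subset S -> ext_coef x A = 0) -> ext_coef (x * y) S = 0.
Proof.
move=> x0; rewrite ext_coefM big1 // => A _; rewrite big1 // => B /eqP eS.
by rewrite x0 ?mul0r ?mulr0 // -eS subsetUl.
Qed.

Lemma ext_coefM_supr x y S :
  (forall B, B \subset S -> ext_coef y B = 0) -> ext_coef (x * y) S = 0.
Proof.
move=> y0; rewrite ext_coefM big1 // => A _; rewrite big1 // => B /eqP eS.
by rewrite y0 ?mulr0 // -eS subsetUr.
Qed.

Lemma ext_sign_sqr A B : [disjoint A & B] -> ext_sign k A B * ext_sign k A B = 1.
Proof. by rewrite /ext_sign => ->; rewrite -expr2 sqrr_sign. Qed.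

Lemma deg1_coefM_basis (l : E) A S : ext_deg1 l ->
  #|S| != #|A|.+1 -> ext_coef (l * ext_basis k A) S = 0.
Proof.
move=> [c ->] neS; rewrite mulr_suml ext_coef_sum big1 // => i _.
rewrite -scalerAl ext_basisM scalerA ext_coefZ ext_ofE.
case: eqP => [eS|_]; last by rewrite mulr0.
rewrite /ext_sign disjoints1; case: ifPn => [iA|_]; last by rewrite mulr0 mul0r.
by rewrite eS cardsU1 iA eqxx in neS.
Qed.

End ExteriorSupport.

(** * The quotient by the edge ideal *)

Section EdgeRing.
Variables (k : comNzRingType) (n : nat) (G : sgraph n).
Local Notation E := (exterior k n).
Implicit Types (x y : E) (S : {set 'I_n}).

(** The edge ideal is spanned by the monomials e_S with S dependent: such a
    monomial is, up to sign, e_i e_j e_(S minus i, j) for an edge (i, j) inside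
    S, and conversely a multiple of e_i e_j has no monomial avoiding i or j. *)
Lemma mem_edge_idealP x :
  reflect (forall S, indep (edge G) S -> ext_coef x S = 0) (x \in edge_ideal k G).
Proof.
apply: (iffP idP) => [/submod_spanP[r [a [z [zG ->]]]] S indS | x0].
  rewrite ext_coef_sum big1 // => t _.
  have [i [j [b [Gij ->]]]] := zG t.
  apply: ext_coefM_supr => B BS; apply: ext_coefM_supl => A AB.
  rewrite ext_basisM ext_coefZ ext_ofE; case: eqP => [eA|_]; last by rewrite mulr0.
  have /indepP/(_ i j) := indepS (subset_trans AB BS) indS.
  by rewrite eA !inE !eqxx orbT Gij => /(_ isT isT).
rewrite (ext_basis_expand x); apply: (@rpred_sum E^o (edge_ideal k G)) => S _.
have [indS|] := boolP (indep (edge G) S); first by rewrite x0 // scale0r (@rpred0 E^o).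
rewrite negb_forall_in => /exists_inP[i iS]; rewrite negb_forall_in.
move=> /exists_inP[j jS]; rewrite negbK => Gij.
set c := ext_coef x S.
have ne_ij : i != j by apply: contraTneq Gij => ->; rewrite edge_irr.
have d1 : [disjoint [set i] & [set j]] by rewrite disjoints1 inE.
have d2 : [disjoint [set i] :|: [set j] & S :\: [set i; j]].
  by rewrite -setI_eq0 setIDA setIC -setIDA setDv setI0.
apply: submod_span_gen; exists i, j.
(* Each reordering sign is its own inverse, so it is put into the cofactor. *)
exists ((c * ext_sign k [set i] [set j] *
   ext_sign k ([set i] :|: [set j]) (S :\: [set i; j])) *:
     ext_basis k (S :\: [set i; j])).
split=> //; rewrite ext_basisM -scalerAr -scalerAl ext_basisM !scalerA.
rewrite (_ : _ :|: (S :\: _) = S); last first.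
  by rewrite setUC setDE setUIl [~: _ :|: _]setUC setUCr setIT; apply/setUidPl;
     rewrite subUset !sub1set iS.
rewrite [_ * _ * _ * ext_sign k [set i] _]mulrAC -(mulrA c) ext_sign_sqr // mulr1.
by rewrite -mulrA ext_sign_sqr // mulr1.
Qed.

(** Regularity on the quotient, lifted to representatives in E. *)
Lemma regular_edge_ring_iff (l : E) : regular_elt (edge_ring k G) l <->
  forall x, l * x \in edge_ideal k G <->
    exists y, x - l * y \in edge_ideal k G.
Proof.
have piM y : l *: quotmod_pi (edge_ideal k G) y = quotmod_pi (edge_ideal k G) (l * y).
  exact: quotmod_scale_pi.
have pi0 x : (quotmod_pi (edge_ideal k G) x = 0) <-> (x \in edge_ideal k G).
  split=> [/eqP|xI].
    by rewrite -(raddf0 (quotmod_pi (edge_ideal k G))) quotmod_piP subr0.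
  by apply/eqP; rewrite -(raddf0 (quotmod_pi (edge_ideal k G))) quotmod_piP subr0.
have piB x y : (quotmod_pi (edge_ideal k G) x = l *: quotmod_pi (edge_ideal k G) y)
    <-> (x - l * y \in edge_ideal k G).
  by rewrite piM; split=> [/eqP|h]; [|apply/eqP]; rewrite quotmod_piP.
split=> [regl x | regl m].
  rewrite -pi0 -piM; split=> [/regl[m]|[y /piB eq_y]].
    by have [y <-] := quotmod_surj m => /piB; exists y.
  by apply/regl; exists (quotmod_pi (edge_ideal k G) y).
have [x <-] := quotmod_surj m; rewrite piM pi0.
split=> [/regl[y /piB eq_y]|[m']]; first by exists (quotmod_pi (edge_ideal k G) y).
by have [y <-] := quotmod_surj m' => /piB eq_y; apply/regl; exists y.
Qed.

End EdgeRing.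

(** * Regular linear forms and the Euler characteristic *)

Section EulerCharacteristic.
Variables (k : fieldType) (n : nat) (G : sgraph n).
Local Notation E := (exterior k n).
Let Ind : {set {set 'I_n}} := [set S | indep (edge G) S].
Let N := #|Ind|.
Let face (i : 'I_N) : {set 'I_n} := enum_val i.

Lemma indep_face (i : 'I_N) : indep (edge G) (face i).
Proof. by have := enum_valP i; rewrite inE. Qed.

(** [face_coord] identifies E/I(G) with row vectors indexed by the independent
    sets, the faces of the independence complex. *)
Definition face_coord (x : E) : 'rV[k]_N := \row_i ext_coef x (face i).

Lemma face_coord_eq0 (x : E) : face_coord x = 0 <-> x \in edge_ideal k G.
Proof.
split=> [x0|/mem_edge_idealP x0].
  apply/mem_edge_idealP => S indS; have SI : S \in Ind by rewrite inE.
  have /rowP/(_ (enum_rank_in SI S)) := x0.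
  by rewrite !mxE /face enum_rankK_in.
by apply/rowP => i; rewrite !mxE x0 // indep_face.
Qed.

Lemma face_coord_surj (v : 'rV[k]_N) : exists x, face_coord x = v.
Proof.
exists (\sum_i v 0 i *: ext_basis k (face i)); apply/rowP => j.
rewrite !mxE ext_coef_sum (bigD1 j) //= ext_coefZ ext_ofE eqxx mulr1 big1 ?addr0 //.
move=> i ne_ij; rewrite ext_coefZ ext_ofE (inj_eq enum_val_inj) eq_sym.
by rewrite (negPf ne_ij) mulr0.
Qed.

Definition mul_face_mx (l : E) : 'M[k]_N :=
  \matrix_(i, j) ext_coef (l * ext_basis k (face i)) (face j).

Lemma face_coordM (l x : E) : face_coord (l * x) = face_coord x *m mul_face_mx l.
Proof.
apply/rowP => j; rewrite !mxE {1}(ext_basis_expand x) mulr_sumr ext_coef_sum.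
rewrite (bigID (mem Ind)) /= [X in _ + X]big1 ?addr0; last first.
  move=> S; rewrite inE => depS; rewrite -scalerAr ext_coefZ.
  rewrite ext_coefM_supr ?mulr0 // => B Bj; rewrite ext_ofE.
  case: eqP => // eB; case/negP: depS; rewrite -eB.
  exact: indepS Bj (indep_face j).
rewrite big_enum_val; apply: eq_bigr => i _.
by rewrite !mxE -scalerAr ext_coefZ.
Qed.

(** Multiplication by l is an exact differential on E/I(G) that anticommutes
    with the parity operator, whose trace is the alternating count. *)
Lemma regular_indep_chi (l : E) : ext_deg1 l -> regular_elt (edge_ring k G) l ->
  (indep_chi (edge G) setT)%:~R = 0 :> k.
Proof.
move=> deg_l /regular_edge_ring_iff regl.
set A := mul_face_mx l.
pose D : 'M[k]_N := diag_mx (\row_i (-1) ^+ #|face i|).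
have kerA x : face_coord x *m A = 0 <-> exists y, face_coord x = face_coord y *m A.
  rewrite -face_coordM face_coord_eq0 regl; split=> [[y xy]|[y xy]]; exists y.
    apply/eqP; rewrite -subr_eq0 -face_coordM; apply/eqP.
    by move/face_coord_eq0: xy => <-; apply/rowP => i; rewrite !mxE ext_coefD ext_coefN.
  apply/face_coord_eq0; apply/rowP => i; move/rowP/(_ i): xy.
  by rewrite -face_coordM !mxE ext_coefD ext_coefN => ->; rewrite subrr.
(* Regularity alone gives A^2 = 0, as everything in the image is in the kernel. *)
have A2 : A *m A = 0.
  apply/row_matrixP => i; rewrite row_mul row0 rowE.
  have [x <-] := face_coord_surj (delta_mx 0 i).
  by rewrite -face_coordM; apply/kerA; exists x; rewrite face_coordM.
have exactA (v : 'rV_N) : v *m A = 0 -> (v <= A)%MS.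
  by have [x <-] := face_coord_surj v => /kerA[y ->]; apply: submxMl.
have DA : D *m A = - (A *m D).
  apply/matrixP => i j; rewrite mul_diag_mx mul_mx_diag !mxE.
  have [eS|neS] := eqVneq #|face j| #|face i|.+1.
    by rewrite eS exprS mulN1r mulrN opprK mulrC.
  by rewrite deg1_coefM_basis // mulr0 mul0r oppr0.
rewrite -(mxtrace_anticomm_exact A2 exactA DA) mxtrace_diag rmorph_sum /=.
rewrite (eq_bigl (fun S => S \in Ind)) => [|S]; last by rewrite subsetT inE.
by rewrite big_enum_val; apply: eq_bigr => i _; rewrite !mxE rmorphXn rmorphN1.
Qed.

End EulerCharacteristic.

(** * Regular sequences on the cycle *)

(** The first term of a regular sequence is regular on the quotient of M by the
    submodule generated by nothing, that is, on M itself. *)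
Lemma regular_seq_quotmod_nil (k : comNzRingType) (n : nat)
    (M : lmodType (exterior k n)) (l : exterior k n) :
  regular_elt (seq_quotmod M [::]) l -> regular_elt M l.
Proof.
rewrite /regular_elt /seq_quotmod; set N := submod_span _ => regl m.
have piI (x y : M) : quotmod_pi N x = quotmod_pi N y <-> x = y.
  split=> [/eqP|-> //]; rewrite quotmod_piP => /submod_spanP[r [a [z [zN]]]].
  by rewrite big1 => [/subr0_eq //|i _]; case: (zN i) => ?; rewrite in_nil.
have piZ x : l *: quotmod_pi N x = quotmod_pi N (l *: x) by exact: quotmod_scale_pi.
have pi0 : 0 = quotmod_pi N 0 by rewrite raddf0.
split=> [lm0|[m' ->]].
  have [|q] := (regl (quotmod_pi N m)).1; first by rewrite piZ lm0 -pi0.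
  by have [m' <-] := quotmod_surj q; rewrite piZ piI => ->; exists m'.
apply/piI; rewrite -piZ -pi0; apply/regl; exists (quotmod_pi N m').
by rewrite piZ.
Qed.

Unset Implicit Arguments.

Theorem theorem3p7 (k : closedFieldType) (k_char0 : [pchar k] =i pred0)
  (n : nat) (n_ge3 : (3 <= n)%N) :
  depth_is (edge_ring k (cycle_graph n)) 0.
Proof.
split=> [|[|l s] // regs]; first by exists [::].
have [//|deg_l /regular_seq_quotmod_nil regl] := regs 0%N.
have /pcharf0P nat_eq0 := k_char0.
have /eqP := regular_indep_chi deg_l regl.
have /= := cycle_chi_neq0 n_ge3; case: (indep_chi _ _) => m chi_neq0.
  by rewrite nat_eq0 -eqz_nat (negPf chi_neq0).
by rewrite NegzE rmorphN oppr_eq0 nat_eq0.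
Qed.
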